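(* Let $(A,\diamond,*,[\,,\,,\,],[\![\,,\,,\,]\!])$ be any NS-Nambu-Poisson algebra, with subadjacent Nambu-Poisson algebra $(A,\odot,\{\!\!\{\,,\,,\,\}\!\!\})$, its representation $(A;\mu_\diamond,\rho_{[\,,\,,\,]})$ given by $\mu_\diamond(a)b=a\diamond b$, $\rho_{[\,,\,,\,]}(a,b)c=[a,b,c]$, and the Nambu-Poisson $2$-cocycle $(\varphi_*,\psi_{[\![\,,\,,\,]\!]})$ given by $\varphi_*(a,b)=a*b$, $\psi_{[\![\,,\,,\,]\!]}(a,b,c)=[\![a,b,c]\!]$. Then the identity map $\mathrm{Id}:A\to A$ is a $(\varphi_*,\psi_{[\![\,,\,,\,]\!]})$-twisted $\mathcal{O}$-operator on the Nambu-Poisson algebra $(A,\odot,\{\!\!\{\,,\,,\,\}\!\!\})$ with respect to the representation $(A;\mu_\diamond,\rho_{[\,,\,,\,]})$. Moreover, the NS-Nambu-Poisson algebra structure on $A$ induced by this twisted $\mathcal{O}$-operator coincides with the given one.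
   Context: All vector spaces and (multi)linear maps are over a field $k$ of characteristic $0$. A 3-Lie algebra is a vector space $\mathcal L$ with a skew-symmetric trilinear operation $\{\,,\,,\,\}$ satisfying $\{a,b,\{c,d,e\}\}=\{\{a,b,c\},d,e\}+\{c,\{a,b,d\},e\}+\{c,d,\{a,b,e\}\}$. A Nambu-Poisson algebra $(A,\cdot,\{\,,\,,\,\})$ is a commutative associative algebra $(A,\cdot)$ (not assumed unital) together with a 3-Lie algebra structure $\{\,,\,,\,\}$ on $A$ such that $\{a,b,c\cdot d\}=\{a,b,c\}\cdot d+c\cdot\{a,b,d\}$ for all $a,b,c,d\in A$. A representation of a Nambu-Poisson algebra $(A,\cdot,\{\,,\,,\,\})$ is a triple $(V;\mu,\rho)$ of a vector space $V$, a linear map $\mu:A\to\mathrm{End}(V)$ and a skew-symmetric bilinear map $\rho:A\times A\to\mathrm{End}(V)$ such that for all $a,b,c,d\in A$: $\mu(a\cdot b)=\mu(a)\mu(b)$; $\rho(a,b)\rho(c,d)-\rho(c,d)\rho(a,b)=\rho(\{a,b,c\},d)+\rho(c,\{a,b,d\})$; $\rho(\{a,b,c\},d)=\rho(a,b)\rho(c,d)+\rho(b,c)\rho(a,d)+\rho(c,a)\rho(b,d)$; $\mu(\{a,b,c\})=\rho(a,b)\mu(c)-\mu(c)\rho(a,b)$; $\rho(a,b\cdot c)=\mu(b)\rho(a,c)+\mu(c)\rho(a,b)$. A Nambu-Poisson 2-cocycle of $A$ with coefficients in $(V;\mu,\rho)$ is a pair $(\varphi,\psi)$ where: (1) $\varphi:A\times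 A\to V$ is a Harrison 2-cocycle, i.e. bilinear, symmetric, with $\mu(a)\varphi(b,c)-\varphi(a\cdot b,c)+\varphi(a,b\cdot c)-\mu(c)\varphi(a,b)=0$; (2) $\psi:A\times A\times A\to V$ is a 3-Lie 2-cocycle, i.e. trilinear, skew-symmetric, with $\psi(a,b,\{c,d,e\})+\rho(a,b)\psi(c,d,e)=\psi(\{a,b,c\},d,e)+\psi(c,\{a,b,d\},e)+\psi(c,d,\{a,b,e\})+\rho(d,e)\psi(a,b,c)+\rho(e,c)\psi(a,b,d)+\rho(c,d)\psi(a,b,e)$; (3) $\psi(a,b,c\cdot d)+\rho(a,b)\varphi(c,d)=\varphi(c,\{a,b,d\})+\mu(c)\psi(a,b,d)+\varphi(\{a,b,c\},d)+\mu(d)\psi(a,b,c)$, for all $a,b,c,d,e\in A$. A $(\varphi,\psi)$-twisted $\mathcal O$-operator on $A$ with respect to $(V;\mu,\rho)$ is a linear map $r:V\to A$ such that for all $u,v,w\in V$: $r(u)\cdot r(v)=r\big(\mu(r(u))v+\mu(r(v))u+\varphi(r(u),r(v))\big)$ and $\{r(u),r(v),r(w)\}=r\big(\rho(r(u),r(v))w+\rho(r(v),r(w))u+\rho(r(w),r(u))v+\psi(r(u),r(v),r(w))\big)$. The NS-Nambu-Poisson structure on $V$ induced by such $r$ is $u\diamond_r v=\mu(r(u))v$, $u*_r v=\varphi(r(u),r(v))$, $[u,v,w]_r=\rho(r(u),r(v))w$, $[\![u,v,w]\!]_r=\psi(r(u),r(v),r(w))$. An NS-commutative algebra is $(A,\diamond,*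 )$ with bilinear operations $\diamond,*$ on $A$, $*$ commutative, such that, with $a\odot b=a\diamond b+b\diamond a+a*b$: $a\diamond(b\diamond c)=(a\odot b)\diamond c$ and $a\diamond(b*c)+a*(b\odot c)=b\diamond(a*c)+b*(a\odot c)$. An NS-3-Lie algebra is $(A,[\,,\,,\,],[\![\,,\,,\,]\!])$ with trilinear operations on $A$, $[\,,\,,\,]$ skew-symmetric in the first two arguments and $[\![\,,\,,\,]\!]$ completely skew-symmetric, such that, with $\{\!\!\{a,b,c\}\!\!\}=[a,b,c]+[b,c,a]+[c,a,b]+[\![a,b,c]\!]$: $[a,b,[c,d,e]]=[\{\!\!\{a,b,c\}\!\!\},d,e]+[c,\{\!\!\{a,b,d\}\!\!\},e]+[c,d,[a,b,e]]$; $[\{\!\!\{a,b,c\}\!\!\},d,e]=[a,b,[c,d,e]]+[b,c,[a,d,e]]+[c,a,[b,d,e]]$; $[\![a,b,\{\!\!\{c,d,e\}\!\!\}]\!]+[a,b,[\![c,d,e]\!]]=[\![\{\!\!\{a,b,c\}\!\!\},d,e]\!]+[\![c,\{\!\!\{a,b,d\}\!\!\},e]\!]+[\![c,d,\{\!\!\{a,b,e\}\!\!\}]\!]+[d,e,[\![a,b,c]\!]]+[e,c,[\![a,b,d]\!]]+[c,d,[\![a,b,e]\!]]$. An NS-Nambu-Poisson algebra is $(A,\diamond,*,[\,,\,,\,],[\![\,,\,,\,]\!])$ such that $(A,\diamond,* )$ is an NS-commutative algebra, $(A,[\,,\,,\,],[\![\,,\,,\,]\!])$ is an NS-3-Lie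 algebra, and for all $a,b,c,d\in A$: $\{\!\!\{a,b,c\}\!\!\}\diamond d=[a,b,c\diamond d]-c\diamond[a,b,d]$; $[a\odot b,c,d]=a\diamond[b,c,d]+b\diamond[a,c,d]$; $[\![a,b,c\odot d]\!]+[a,b,c*d]=c*\{\!\!\{a,b,d\}\!\!\}+c\diamond[\![a,b,d]\!]+\{\!\!\{a,b,c\}\!\!\}*d+d\diamond[\![a,b,c]\!]$. Its subadjacent Nambu-Poisson algebra is $(A,\odot,\{\!\!\{\,,\,,\,\}\!\!\})$. *)

(* Defs.v *)
From HB Require Import structures.
From mathcomp Require Import all_boot all_order all_algebra.

Set Implicit Arguments.
Unset Strict Implicit.
Unset Printing Implicit Defensive.

Import GRing.Theory.
Local Open Scope ring_scope.

(* Each kind of structure is a record of bare operations (suffix [_ops]) together *)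
(* with a predicate on that record stating (multi)linearity, symmetry and the      *)
(* axioms.  Maps into End(V) are uncurried: [A -> V -> V] for A -> End(V) and      *)
(* [A -> A -> V -> V] for A x A -> End(V), linearity in V being part of            *)
(* [bilinear] and [trilinear].                                                     *)

Section Multilinear.
Variables (k : fieldType) (U1 U2 U3 V : lmodType k).

Definition bilinear (f : U1 -> U2 -> V) : Prop :=
  bilinear_for *:%R *:%R f.

Definition trilinear (f : U1 -> U2 -> U3 -> V) : Prop :=
  [/\ forall b c, linear (fun a => f a b c),
      forall a c, linear (fun b => f a b c)
    & forall a b, linear (f a b)].
End Multilinear.

Section Symmetry.
Variables (T : Type) (V : zmodType).

(* The two adjacent transpositions generate S_3. *)
Definition skew3 (f : T -> T -> T -> V) : Prop :=
  (forall a b c, f b a c = - f a b c) /\ (forall a b c, f a c b = - f a b c).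
End Symmetry.

Record np_ops (A : Type) := NPOps {
  np_mul : A -> A -> A;
  np_br : A -> A -> A -> A }.

Record rep_ops (A V : Type) := RepOps {
  rep_mu : A -> V -> V;
  rep_rho : A -> A -> V -> V }.

Record cochain_ops (A V : Type) := CochainOps {
  cochain_phi : A -> A -> V;
  cochain_psi : A -> A -> A -> V }.

(* [ns_dia a b] is a ⋄ b, [ns_star a b] is a * b, [ns_br a b c] is [a, b, c]    *)
(* and [ns_dbr a b c] is [[a, b, c]].                                            *)
Record ns_ops (A : Type) := NSOps {
  ns_dia : A -> A -> A;
  ns_star : A -> A -> A;
  ns_br : A -> A -> A -> A;
  ns_dbr : A -> A -> A -> A }.

Section NambuPoisson.
Variables (k : fieldType) (A : lmodType k).

Definition comm_assoc_algebra (mul : A -> A -> A) : Prop :=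
  [/\ bilinear mul, commutative mul & associative mul].

Definition three_Lie_algebra (br : A -> A -> A -> A) : Prop :=
  [/\ trilinear br, skew3 br
    & forall a b c d e,
        br a b (br c d e) =
        br (br a b c) d e + br c (br a b d) e + br c d (br a b e)].

Definition Nambu_Poisson_algebra (P : np_ops A) : Prop :=
  let: NPOps mul br := P in
  [/\ comm_assoc_algebra mul, three_Lie_algebra br
    & forall a b c d, br a b (mul c d) = mul (br a b c) d + mul c (br a b d)].

Variable V : lmodType k.

Definition Nambu_Poisson_rep (P : np_ops A) (R : rep_ops A V) : Prop :=
  let: NPOps mul br := P in
  let: RepOps mu rho := R in
  [/\ bilinear mu,
      trilinear rho
    & forall a b v, rho b a v = - rho a b v]
  /\
  [/\ forall a b v, mu (mul a b) v = mu a (mu b v),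
      forall a b c d v,
        rho a b (rho c d v) - rho c d (rho a b v) =
        rho (br a b c) d v + rho c (br a b d) v,
      forall a b c d v,
        rho (br a b c) d v =
        rho a b (rho c d v) + rho b c (rho a d v) + rho c a (rho b d v),
      forall a b c v, mu (br a b c) v = rho a b (mu c v) - mu c (rho a b v)
    & forall a b c v, rho a (mul b c) v = mu b (rho a c v) + mu c (rho a b v)].

Definition Harrison_2cocycle (mul : A -> A -> A) (mu : A -> V -> V)
    (phi : A -> A -> V) : Prop :=
  [/\ bilinear phi,
      forall a b, phi a b = phi b a
    & forall a b c,
        mu a (phi b c) - phi (mul a b) c + phi a (mul b c) - mu c (phi a b) = 0].

Definition three_Lie_2cocycle (br : A -> A -> A -> A) (rho : A -> A -> V -> V)
    (psi : A -> A -> A -> V) : Prop :=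
  [/\ trilinear psi, skew3 psi
    & forall a b c d e,
        psi a b (br c d e) + rho a b (psi c d e) =
        psi (br a b c) d e + psi c (br a b d) e + psi c d (br a b e)
        + rho d e (psi a b c) + rho e c (psi a b d) + rho c d (psi a b e)].

Definition Nambu_Poisson_2cocycle (P : np_ops A) (R : rep_ops A V)
    (C : cochain_ops A V) : Prop :=
  let: NPOps mul br := P in
  let: RepOps mu rho := R in
  let: CochainOps phi psi := C in
  [/\ Harrison_2cocycle mul mu phi,
      three_Lie_2cocycle br rho psi
    & forall a b c d,
        psi a b (mul c d) + rho a b (phi c d) =
        phi c (br a b d) + mu c (psi a b d) + phi (br a b c) d
        + mu d (psi a b c)].

Definition twisted_O_operator (P : np_ops A) (R : rep_ops A V)
    (C : cochain_ops A V) (r : V -> A) : Prop :=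
  let: NPOps mul br := P in
  let: RepOps mu rho := R in
  let: CochainOps phi psi := C in
  [/\ linear r,
      forall u v,
        mul (r u) (r v) = r (mu (r u) v + mu (r v) u + phi (r u) (r v))
    & forall u v w,
        br (r u) (r v) (r w) =
        r (rho (r u) (r v) w + rho (r v) (r w) u + rho (r w) (r u) v
           + psi (r u) (r v) (r w))].

Definition induced_NS (R : rep_ops A V) (C : cochain_ops A V) (r : V -> A) :
    ns_ops V :=
  NSOps (fun u v => rep_mu R (r u) v)
        (fun u v => cochain_phi C (r u) (r v))
        (fun u v w => rep_rho R (r u) (r v) w)
        (fun u v w => cochain_psi C (r u) (r v) (r w)).
End NambuPoisson.

Section NSNambuPoisson.
Variables (k : fieldType) (A : lmodType k).

Definition ns_odot (dia star : A -> A -> A) (a b : A) : A :=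
  dia a b + dia b a + star a b.

Definition ns_tribr (br dbr : A -> A -> A -> A) (a b c : A) : A :=
  br a b c + br b c a + br c a b + dbr a b c.

Definition NS_commutative_algebra (dia star : A -> A -> A) : Prop :=
  let odot := ns_odot dia star in
  [/\ bilinear dia, bilinear star & commutative star]
  /\
  [/\ forall a b c, dia a (dia b c) = dia (odot a b) c
    & forall a b c,
        dia a (star b c) + star a (odot b c) =
        dia b (star a c) + star b (odot a c)].

Definition NS_3Lie_algebra (br dbr : A -> A -> A -> A) : Prop :=
  let tri := ns_tribr br dbr in
  [/\ trilinear br, trilinear dbr,
      forall a b c, br b a c = - br a b c
    & skew3 dbr]
  /\
  [/\ forall a b c d e,
        br a b (br c d e) =
        br (tri a b c) d e + br c (tri a b d) e + br c d (br a b e),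
      forall a b c d e,
        br (tri a b c) d e =
        br a b (br c d e) + br b c (br a d e) + br c a (br b d e)
    & forall a b c d e,
        dbr a b (tri c d e) + br a b (dbr c d e) =
        dbr (tri a b c) d e + dbr c (tri a b d) e + dbr c d (tri a b e)
        + br d e (dbr a b c) + br e c (dbr a b d) + br c d (dbr a b e)].

Definition NS_Nambu_Poisson_algebra (N : ns_ops A) : Prop :=
  let: NSOps dia star br dbr := N in
  let odot := ns_odot dia star in
  let tri := ns_tribr br dbr in
  [/\ NS_commutative_algebra dia star & NS_3Lie_algebra br dbr]
  /\
  [/\ forall a b c d, dia (tri a b c) d = br a b (dia c d) - dia c (br a b d),
      forall a b c d, br (odot a b) c d = dia a (br b c d) + dia b (br a c d)
    & forall a b c d,
        dbr a b (odot c d) + br a b (star c d) =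
        star c (tri a b d) + dia c (dbr a b d) + star (tri a b c) d
        + dia d (dbr a b c)].

Definition subadjacent (N : ns_ops A) : np_ops A :=
  NPOps (ns_odot (ns_dia N) (ns_star N)) (ns_tribr (ns_br N) (ns_dbr N)).

Definition ns_rep (N : ns_ops A) : rep_ops A A :=
  RepOps (ns_dia N) (ns_br N).

Definition ns_cocycle (N : ns_ops A) : cochain_ops A A :=
  CochainOps (ns_star N) (ns_dbr N).
End NSNambuPoisson.

(* Main.v *)
Require Import Defs.
From mathcomp Require Import all_boot all_order all_algebra.
Import GRing.Theory.
Local Open Scope ring_scope.

(* The representation and cocycle axioms are the NS axioms up to skew-symmetry.
   The axioms of the subadjacent algebra are sums of NS axioms over permuted
   arguments: in the fundamental identity, the axiom for [a,b,[c,d,e]] is used at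
   the three cyclic permutations of (c,d,e), the axiom for [{{c,d,e}},a,b] as it
   stands and with its last two slots exchanged, and the cocycle axiom once. *)

(* The leading 0 gives every summand a left neighbour, so that [addrAC] alone can
   move any of them to the end. *)
Ltac same_summands :=
  rewrite -[LHS]add0r -[RHS]add0r ?addrA;
  repeat (match goal with |- _ + ?x = _ => rewrite ?[in RHS](addrAC _ x) end;
          congr (_ + _));
  reflexivity.

Section Additivity.
Context {k : fieldType} {U V : lmodType k}.

Lemma linear_add (f : U -> V) : linear f -> {morph f : a b / a + b}.
Proof. by move=> lin_f a b; have := lin_f 1 a b; rewrite !scale1r. Qed.

Lemma linear_opp (f : U -> V) : linear f -> {morph f : a / - a}.
Proof.
move=> lin_f a; apply: (addIr (f a)).
rewrite -linear_add // !addNr.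
by apply: (addIr (f 0)); rewrite -linear_add // !add0r.
Qed.
End Additivity.

Section NSCommutative.
Context {k : fieldType} {A : lmodType k} {dia star : A -> A -> A}.
Hypothesis NSC : NS_commutative_algebra dia star.
Local Notation odot := (ns_odot dia star).

Lemma ns_odotE a b : odot a b = dia a b + dia b a + star a b.
Proof. by []. Qed.

Lemma ns_odotC : commutative odot.
Proof.
have [[_ _ starC] _] := NSC.
by move=> a b; rewrite /ns_odot starC [dia a b + _]addrC.
Qed.

Lemma ns_odot_bilinear : Defs.bilinear odot.
Proof.
have [[[dl dr] [sl sr] _] _] := NSC.
split=> [c t a b | c t a b]; rewrite /ns_odot /=.
  by rewrite (dl c t a b) (dr c t a b) (sl c t a b) !scalerDr; same_summands.
by rewrite (dl c t a b) (dr c t a b) (sr c t a b) !scalerDr; same_summands.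
Qed.

Lemma ns_dia_odotr a b c :
  dia a (odot b c) = dia a (dia b c) + dia a (dia c b) + dia a (star b c).
Proof. by have [[[_ dr] _ _] _] := NSC; rewrite /ns_odot !(linear_add _ (dr a)). Qed.

(** Both sides are the action on [c] of one product, [odot a b], which is commutative. *)
Lemma ns_diaCA a b c : dia a (dia b c) = dia b (dia a c).
Proof. by have [_ [diaA _]] := NSC; rewrite !diaA ns_odotC. Qed.

Lemma ns_odotA : associative odot.
Proof.
have [[_ _ starC] [diaA starJ]] := NSC.
move=> a b c.
(* Taking [c] in the middle makes the axiom exchange the outer arguments [a] and [c]: its two sides
   are the [star] contributions to the two bracketings of the triple product. *)
have Ja := starJ a c b; rewrite (starC c b) (ns_odotC c b) in Ja.
transitivity (dia a (dia b c) + dia a (dia c b) + dia b (dia c a)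
              + (dia a (star b c) + star a (odot b c))).
  by rewrite [LHS]ns_odotE ns_dia_odotr -diaA; same_summands.
rewrite {}Ja [RHS]ns_odotE ns_dia_odotr -diaA (starC _ c).
by rewrite (ns_diaCA a c) (ns_diaCA b c); same_summands.
Qed.

Lemma comm_assoc_odot : comm_assoc_algebra odot.
Proof. by split; [exact: ns_odot_bilinear | exact: ns_odotC | exact: ns_odotA]. Qed.

(** The [star] axiom at [(a, c, b)] is the Harrison identity with its negative terms moved to the
    right. *)
Lemma Harrison_2cocycle_star : Harrison_2cocycle odot dia star.
Proof.
have [[_ star_bil starC] [_ starJ]] := NSC.
split=> // a b c.
have Ja := starJ a c b; rewrite (starC c b) (ns_odotC c b) in Ja.
by rewrite (addrAC (dia a _)) Ja (starC _ c) addrK subrr.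
Qed.
End NSCommutative.

Section NS3Lie.
Context {k : fieldType} {A : lmodType k} {br dbr : A -> A -> A -> A}.
Hypothesis NSL : NS_3Lie_algebra br dbr.
Local Notation tri := (ns_tribr br dbr).

Lemma ns_tribrE a b c : tri a b c = br a b c + br b c a + br c a b + dbr a b c.
Proof. by []. Qed.

Lemma ns_br_swap a b c : br b a c = - br a b c.
Proof. by have [[_ _ + _] _] := NSL; exact. Qed.

Lemma ns_tribr_trilinear : trilinear tri.
Proof.
have [[[b1 b2 b3] [d1 d2 d3] _ _] _] := NSL.
split=> [y z | x z | x y] t u v; rewrite /ns_tribr /=.
- rewrite (b1 y z t u v) (b2 z y t u v) (b3 y z t u v) (d1 y z t u v).
  by rewrite !scalerDr; same_summands.
- rewrite (b2 x z t u v) (b1 z x t u v) (b3 z x t u v) (d2 x z t u v).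
  by rewrite !scalerDr; same_summands.
rewrite (b3 x y t u v) (b2 y x t u v) (b1 x y t u v) (d3 x y t u v).
by rewrite !scalerDr; same_summands.
Qed.

(** A transposition reverses the cyclic order; skewness of [br] in its first two slots then turns
    each reversed term into minus a term of the original cyclic sum. *)
Lemma ns_tribr_skew3 : skew3 tri.
Proof.
have [[_ _ _ [dbr12 dbr23]] _] := NSL.
split=> a b c; rewrite /ns_tribr.
  rewrite dbr12 (ns_br_swap a b) (ns_br_swap c a) (ns_br_swap b c) !opprD.
  by same_summands.
rewrite dbr23 (ns_br_swap a b) (ns_br_swap c a) (ns_br_swap b c) !opprD.
by same_summands.
Qed.

Lemma ns_br_tribr a b c d e :
  br a b (tri c d e)
  = br a b (br c d e) + br a b (br d e c) + br a b (br e c d)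
    + br a b (dbr c d e).
Proof.
by have [[[_ _ b3] _ _ _] _] := NSL; rewrite /ns_tribr !(linear_add _ (b3 a b)).
Qed.

Lemma ns_br_tribr2 a b c d e :
  br d (tri a b c) e = br a b (br d c e) + br b c (br d a e) + br c a (br d b e).
Proof.
have [[[_ _ b3] _ _ _] [_ brT _]] := NSL.
rewrite ns_br_swap brT !opprD (ns_br_swap c d) (ns_br_swap a d) (ns_br_swap b d).
by rewrite !(linear_opp _ (b3 _ _)).
Qed.

Lemma ns_tribr_fundamental a b c d e :
  tri a b (tri c d e) =
  tri (tri a b c) d e + tri c (tri a b d) e + tri c d (tri a b e).
Proof.
have [_ [brJ brT dbrJ]] := NSL.
(* The groups come from the four summands of the outer [tri]. The last one also takes
   [br a b (dbr c d e)] from the first summand, which makes it the left side of [dbrJ]. *)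
transitivity (br a b (br c d e) + br a b (br d e c) + br a b (br e c d)
  + (br c d (br b e a) + br d e (br b c a) + br e c (br b d a))
  + (br c d (br e a b) + br d e (br c a b) + br e c (br d a b))
  + (dbr a b (tri c d e) + br a b (dbr c d e))).
  by rewrite [LHS]ns_tribrE ns_br_tribr ns_br_tribr2 brT; same_summands.
rewrite dbrJ !(brJ a b) (ns_tribrE (tri a b c)) (ns_tribrE c (tri a b d)).
rewrite (ns_tribrE c d (tri a b e)) !ns_br_tribr.
by same_summands.
Qed.

Lemma three_Lie_tribr : three_Lie_algebra tri.
Proof.
split; [exact: ns_tribr_trilinear | exact: ns_tribr_skew3 |].
exact: ns_tribr_fundamental.
Qed.
End NS3Lie.

Section NSNambuPoisson.
Context {k : fieldType} {A : lmodType k}.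
Context {dia star : A -> A -> A} {br dbr : A -> A -> A -> A}.
Hypothesis NSN : NS_Nambu_Poisson_algebra (NSOps dia star br dbr).
Local Notation odot := (ns_odot dia star).
Local Notation tri := (ns_tribr br dbr).

(** Skewness carries the axiom from the first slot to the second, the form needed both for the
    representation and for the Leibniz rule. *)
Lemma ns_br_odot2 a b c d :
  br a (odot b c) d = dia b (br a c d) + dia c (br a b d).
Proof.
have [[[[[_ dr] _ _] _] [[_ _ br12 _] _]] [_ br_odot _]] := NSN.
rewrite br12 br_odot opprD (br12 c a) (br12 b a).
by rewrite !(linear_opp _ (dr _)).
Qed.

Lemma ns_br_dia a b c d : br a b (dia c d) = dia (tri a b c) d + dia c (br a b d).
Proof. by have [_ [diaT _ _]] := NSN; rewrite diaT addrNK. Qed.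

Lemma ns_dia_tribr a b c d :
  dia d (tri a b c)
  = dia d (br a b c) + dia d (br b c a) + dia d (br c a b) + dia d (dbr a b c).
Proof.
have [[[[[_ dr] _ _] _] _] _] := NSN.
by rewrite /ns_tribr !(linear_add _ (dr d)).
Qed.

Lemma ns_tribr_Leibniz a b c d :
  tri a b (odot c d) = odot (tri a b c) d + odot c (tri a b d).
Proof.
have [[_ [[[_ _ b3] _ _ _] _]] [_ br_odot dbr_odot]] := NSN.
transitivity (br a b (dia c d) + br a b (dia d c)
  + (dia c (br b d a) + dia d (br b c a)) + (dia c (br d a b) + dia d (br c a b))
  + (dbr a b (odot c d) + br a b (star c d))).
  (* Only the product under [br a b] is unfolded; the one under [dbr a b] stays whole so that
     [dbr_odot] applies to the last group. *)
  rewrite ns_tribrE ns_br_odot2 br_odot {1}/ns_odot.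
  by rewrite !(linear_add _ (b3 a b)); same_summands.
rewrite dbr_odot !ns_br_dia (ns_odotE (tri a b c)) (ns_odotE c).
by rewrite !(ns_dia_tribr a b); same_summands.
Qed.
End NSNambuPoisson.

Theorem proposition5p6 (k : fieldType) (k_char0 : [pchar k] =i pred0)
    (A : lmodType k) (N : ns_ops A) (NS_N : NS_Nambu_Poisson_algebra N) :
  [/\ Nambu_Poisson_algebra (subadjacent N),
      Nambu_Poisson_rep (subadjacent N) (ns_rep N)
    & Nambu_Poisson_2cocycle (subadjacent N) (ns_rep N) (ns_cocycle N)]
  /\
  (twisted_O_operator (subadjacent N) (ns_rep N) (ns_cocycle N) (@id A)
   /\ induced_NS (ns_rep N) (ns_cocycle N) (@id A) = N).
Proof.
case: N NS_N => dia star br dbr NSN.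
have [[NSC NSL] [diaT _ dbr_odot]] := NSN.
have [[dia_bil _ _] [diaA _]] := NSC.
have [[br_tri dbr_tri br12 dbr_skew] [brJ brT dbrJ]] := NSL.
(* For [id] the operator equations unfold to the definitions of [ns_odot] and [ns_tribr], and the
   induced operations reduce to the given ones. *)
split; last by split=> //; split=> // u v w.
split.
- split; [exact: comm_assoc_odot | exact: three_Lie_tribr |].
  exact: ns_tribr_Leibniz.
- split; first by split=> // a b v; exact: br12.
  split=> [a b v | a b c d v | a b c d v | a b c v | a b c v] /=.
  + by rewrite diaA.
  + by rewrite brJ addrK.
  + exact: brT.
  + exact: diaT.
  exact: (ns_br_odot2 NSN).
by split=> //; exact: Harrison_2cocycle_star.
Qed.
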